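(* Let $\mu_1$ and $\mu_2$ be two locally-valid MV assignments of the square grid crease pattern $G_{m,n}$, and let $c$ be a proper 2-vertex coloring, with colors purple and teal, of the graph $\overline{G^*}_{m,n}$ determined by $\mu_1,\mu_2$. Then the smallest number of face flips needed to turn $\mu_1$ into $\mu_2$ equals the minimum of the number of vertices of $G^*_{m,n}$ colored purple by $c$ and the number of vertices of $G^*_{m,n}$ colored teal by $c$.
   Context: Let $m,n\ge 1$. The square grid crease pattern $G_{m,n}$ is the subdivision of an $m\times n$ rectangle $P$ (the paper) into $mn$ unit squares (the faces). The creases (edges) of $G_{m,n}$ are the unit segments of the grid that are shared by two faces (segments on the boundary of $P$ are not creases); $E(G_{m,n})$ is the set of creases. The interior vertices are the $(m-1)(n-1)$ grid points in the interior of $P$; each is incident to exactly four creases. A mountain-valley (MV) assignment is a function $\mu:E(G_{m,n})\to\{-1,1\}$ ($1$ = mountain, $-1$ = valley). It is locally valid if at every interior vertex $v$ the sum of $\mu(e)$ over the four creases $e$ at $v$ equals $2$ or $-2$. Flipping a face $F$ under $\mu$ produces the MV assignment $\mu_F$ with $\mu_F(e)=-\mu(e)$ for every crease $e$ bordering $F$ and $\mu_F(e)=\mu(e)$ for all other creases. The number of face flips needed to turn $\mu_1$ into $\mu_2$ is the length of a sequence of faces whose successive flipping turns $\mu_1$ into $\mu_2$. The internal dual graph $G^*_{m,n}$ has one vertex for each face of $G_{m,n}$ and, for each crease $e$, an edge $e^*$ joining the two faces that share $e$. Given $\mu_1,\mu_2$, put $w(e^* )=|\mu_1(e)+\mu_2(e)|\in\{0,2\}$.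 The graph $\overline{G^*}_{m,n}$ is obtained from $G^*_{m,n}$ by subdividing each edge $e^*$ with $w(e^* )=2$ by one new vertex in its middle. This graph always admits a proper 2-vertex coloring. The vertices of $G^*_{m,n}$ are regarded as vertices of $\overline{G^*}_{m,n}$. *)

(* Defs.v *)
From HB Require Import structures.
From mathcomp Require Import all_boot all_order all_algebra.

Set Implicit Arguments.
Unset Strict Implicit.
Unset Printing Implicit Defensive.

Import Order.TTheory GRing.Theory Num.Theory.
Local Open Scope ring_scope.

(* The paper is P = [0, m] x [0, n]; the face (i, j) is the unit square
   [i, i+1] x [j, j+1]. *)
Definition face (m n : nat) : Type := ('I_m * 'I_n)%type.

(* (x, y) is the grid point of P with these coordinates. *)
Definition grid_point (m n : nat) : Type := ('I_m.+1 * 'I_n.+1)%type.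

Definition interior (m n : nat) (v : grid_point m n) : bool :=
  (0 < v.1 < m)%N && (0 < v.2 < n)%N.

(* All unit segments of the grid, those on the boundary of P included:
   inl (x, y) runs from (x, y) to (x, y+1), inr (x, y) from (x, y) to
   (x+1, y). *)
Definition segment (m n : nat) : Type :=
  (('I_m.+1 * 'I_n) + ('I_m * 'I_n.+1))%type.

Definition side_of (m n : nat) (s : segment m n) (F : face m n) : bool :=
  match s with
  | inl (x, y) => ((x == F.1 :> nat) || (x == F.1.+1 :> nat))
                  && (y == F.2 :> nat)
  | inr (x, y) => (x == F.1 :> nat)
                  && ((y == F.2 :> nat) || (y == F.2.+1 :> nat))
  end.

Definition endpoint_of (m n : nat) (s : segment m n) (v : grid_point m n) :
    bool :=
  match s with
  | inl (x, y) => (v.1 == x :> nat)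
                  && ((v.2 == y :> nat) || (v.2 == y.+1 :> nat))
  | inr (x, y) => ((v.1 == x :> nat) || (v.1 == x.+1 :> nat))
                  && (v.2 == y :> nat)
  end.

Definition is_crease (m n : nat) (s : segment m n) : bool :=
  #|[set F : face m n | side_of s F]| == 2%N.

(* E(G_{m,n}) *)
Definition crease (m n : nat) : Type := {s : segment m n | is_crease s}.

Definition borders (m n : nat) (e : crease m n) (F : face m n) : bool :=
  side_of (val e) F.

Definition incident (m n : nat) (e : crease m n) (v : grid_point m n) : bool :=
  endpoint_of (val e) v.

(* mu takes its values in {-1, 1}; 1 is mountain, -1 is valley. *)
Definition MV_assignment (m n : nat) (mu : {ffun crease m n -> int}) : Prop :=
  forall e : crease m n, mu e = 1 \/ mu e = -1.

Definition locally_valid (m n : nat) (mu : {ffun crease m n -> int}) : Prop :=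
  forall v : grid_point m n, interior v ->
    \sum_(e : crease m n | incident e v) mu e = 2 \/
    \sum_(e : crease m n | incident e v) mu e = -2.

Definition flip (m n : nat) (mu : {ffun crease m n -> int}) (F : face m n) :
    {ffun crease m n -> int} :=
  [ffun e => if borders e F then - mu e else mu e].

(* The faces of s are flipped one after the other, from left to right. *)
Definition flips_to (m n : nat) (s : seq (face m n))
    (mu1 mu2 : {ffun crease m n -> int}) : Prop :=
  foldl (@flip m n) mu1 s = mu2.

(* In particular, if k is the smallest number of flips then mu2 can be
   reached from mu1. *)
Definition smallest_number_of_flips (m n : nat)
    (mu1 mu2 : {ffun crease m n -> int}) (k : nat) : Prop :=
  (exists s : seq (face m n), flips_to s mu1 mu2 /\ size s = k) /\
  (forall s : seq (face m n), flips_to s mu1 mu2 -> (k <= size s)%N).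

(* The edge e^* of the internal dual graph, whose vertices are the faces,
   joins F and F'. *)
Definition dual_edge (m n : nat) (e : crease m n) (F F' : face m n) : bool :=
  [&& F != F', borders e F & borders e F'].

(* w(e^* ) *)
Definition weight (m n : nat) (mu1 mu2 : {ffun crease m n -> int})
    (e : crease m n) : int := `|mu1 e + mu2 e|.

(* Vertices of the subdivided dual graph: the faces (inl), and one new vertex
   (inr) for each crease e such that w(e^* ) = 2. *)
Definition subdiv_vertex (m n : nat) (mu1 mu2 : {ffun crease m n -> int}) :
    Type :=
  (face m n + {e : crease m n | weight mu1 mu2 e == 2})%type.

Definition subdiv_adj (m n : nat) (mu1 mu2 : {ffun crease m n -> int}) :
    rel (subdiv_vertex mu1 mu2) :=
  fun a b =>
    match a, b with
    | inl F, inl F' =>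
        [exists e : crease m n, (weight mu1 mu2 e != 2) && dual_edge e F F']
    | inl F, inr e | inr e, inl F => borders (val e) F
    | inr _, inr _ => false
    end.

Variant color := Purple | Teal.

Definition color_eqb (a b : color) : bool :=
  match a, b with
  | Purple, Purple | Teal, Teal => true
  | _, _ => false
  end.

Lemma color_eqP : Equality.axiom color_eqb.
Proof. by case; case; constructor. Qed.

HB.instance Definition _ := hasDecEq.Build color color_eqP.

Definition proper_coloring (T : Type) (adj : rel T) (c : T -> color) : Prop :=
  forall a b : T, adj a b -> c a != c b.

(* Only the vertices of the internal dual graph are counted, not those created
   by the subdivision. *)
Definition number_colored (m n : nat) (mu1 mu2 : {ffun crease m n -> int})
    (c : subdiv_vertex mu1 mu2 -> color) (k : color) : nat :=
  #|[set F : face m n | c (inl F) == k]|.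

(* Main.v *)
Require Import Defs.
From mathcomp Require Import all_boot all_order all_algebra.

(** Flipping the faces of a sequence s multiplies the value at a crease by -1
    exactly when its two faces occur in s with different parities. So s turns
    mu1 into mu2 if and only if the set of faces flipped an odd number of times
    is separated from its complement precisely by the creases where mu1 and mu2
    differ. The two color classes of c have this property, and since the dual
    graph is connected they are the only such sets. *)

Set Implicit Arguments.
Unset Strict Implicit.
Unset Printing Implicit Defensive.

Import Order.TTheory GRing.Theory Num.Theory.
Local Open Scope ring_scope.

Section Grid.

Variables m n : nat.
Implicit Types (e : crease m n) (F : face m n) (s : seq (face m n)).
Implicit Types mu : {ffun crease m n -> int}.

Lemma crease_facesP e :
  exists F F', F != F' /\ borders e =1 predU (pred1 F) (pred1 F').
Proof.
have /cards2P[F [F' [neqF bE]]] := valP e.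
exists F, F'; split=> // G.
by move/setP/(_ G): bE; rewrite !inE.
Qed.

(** A crease has exactly two sides, so two distinct faces that it borders exhaust them. *)
Lemma dual_edge_borders e F F' :
  dual_edge e F F' -> borders e =1 predU (pred1 F) (pred1 F').
Proof.
have [G [G' [neqG bE]]] := crease_facesP e.
case/and3P=> neqF; rewrite !bE /= => bF bF' H; rewrite bE /=.
move: neqF; case/orP: bF => /eqP->; case/orP: bF' => /eqP->; rewrite ?eqxx //.
by rewrite orbC.
Qed.

Lemma is_crease_pair (x : segment m n) F F' :
  F != F' -> side_of x =1 predU (pred1 F) (pred1 F') ->
  exists e, dual_edge e F F'.
Proof.
move=> neqF xE.
have cx : is_crease x.
  rewrite /is_crease (_ : [set _ | _] = [set F; F']) ?cards2 ?neqF //.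
  by apply/setP=> G; rewrite !inE xE.
by exists (Sub x cx); rewrite /dual_edge /borders SubK neqF !xE /= !eqxx orbT.
Qed.

Lemma dual_edge_fst (i i' : 'I_m) (j : 'I_n) :
  i' = i.+1 :> nat -> exists e, dual_edge e (i, j) (i', j).
Proof.
(* The squares in columns [i] and [i + 1] share the segment on the line of abscissa [i + 1], which
   is [i']. *)
move=> iE; apply: (@is_crease_pair (inl (widen_ord (leqnSn m) i', j))).
  by rewrite xpair_eqE -val_eqE /= iE ltn_eqF.
case=> a b; rewrite /= !xpair_eqE -!val_eqE /= iE eqSS andb_orl orbC.
by rewrite -iE ![_ == val a]eq_sym ![_ == val b]eq_sym.
Qed.

Lemma dual_edge_snd (i : 'I_m) (j j' : 'I_n) :
  j' = j.+1 :> nat -> exists e, dual_edge e (i, j) (i, j').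
Proof.
move=> jE; apply: (@is_crease_pair (inr (i, widen_ord (leqnSn n) j'))).
  by rewrite xpair_eqE -!val_eqE /= jE (ltn_eqF (ltnSn j)) andbF.
case=> a b; rewrite /= !xpair_eqE -!val_eqE /= jE eqSS andb_orr orbC.
by rewrite -jE ![_ == val a]eq_sym ![_ == val b]eq_sym.
Qed.

Lemma ord_step_const (T : Type) k (f : 'I_k -> T) :
  (forall i i' : 'I_k, i' = i.+1 :> nat -> f i = f i') ->
  forall i i', f i = f i'.
Proof.
move=> step.
have mono d (i i' : 'I_k) : i' = (i + d)%N :> nat -> f i = f i'.
  elim: d i' => [|d IHd] i' iE.
    by congr f; apply: val_inj; rewrite /= iE addn0.
  have lt_id : (i + d < k)%N.
    by apply: leq_ltn_trans (ltn_ord i'); rewrite iE leq_add2l.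
  rewrite (IHd (Ordinal lt_id)) //; apply: step.
  by rewrite iE addnS.
move=> i i'; case: (leqP i i') => [|/ltnW] le_i.
  by apply: (mono (i' - i)%N); rewrite subnKC.
by symmetry; apply: (mono (i - i')%N); rewrite subnKC.
Qed.

(** Connectedness of the dual graph, phrased without paths. Any face reaches any other by changing
    the first coordinate in unit steps, then the second. *)
Lemma dual_connected (T : Type) (f : face m n -> T) :
  (forall e F F', dual_edge e F F' -> f F = f F') -> forall F F', f F = f F'.
Proof.
move=> fE [i j] [i' j']; transitivity (f (i', j)).
  apply: (@ord_step_const _ _ (fun i => f (i, j))) => a a' aE.
  by have [e /fE] := dual_edge_fst j aE.
apply: (@ord_step_const _ _ (fun j => f (i', j))) => a a' aE.
by have [e /fE] := dual_edge_snd i' aE.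
Qed.

Lemma foldl_flipE s mu e :
  foldl (@flip m n) mu s e = (-1) ^+ count (borders e) s * mu e.
Proof.
elim: s mu => [|F s IHs] mu /=; first by rewrite mul1r.
rewrite IHs ffunE; case: (borders e F); last by rewrite add0n.
by rewrite exprS mulN1r mulrN mulNr.
Qed.

Lemma count_borders e F F' s : dual_edge e F F' ->
  count (borders e) s = (count_mem F s + count_mem F' s)%N.
Proof.
move=> eF; rewrite (eq_count (dual_edge_borders eF)).
(* Since [F] and [F'] differ, no face is counted twice and the intersection term vanishes. *)
rewrite -count_predUI (@eq_count _ (predI _ _) pred0) ?count_pred0 ?addn0 //.
case/and3P: eF => neqF _ _ G /=.
by apply: contraNF neqF => /andP[/eqP<- /eqP<-].
Qed.

(** With values in {-1, 1}, a change of sign turns agreement into disagreement and conversely. Here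
    [b] stands for the parity of the number of flips at [e]. *)
Lemma MV_assignment_sign_eq mu1 mu2 e (b : bool) :
  MV_assignment mu1 -> MV_assignment mu2 ->
  ((-1) ^+ b * mu1 e == mu2 e) = ((mu1 e == mu2 e) == ~~ b).
Proof.
by move=> mv1 mv2; case: (mv1 e) => ->; case: (mv2 e) => ->; case: b.
Qed.

Lemma flips_to_parityP s mu1 mu2 :
  MV_assignment mu1 -> MV_assignment mu2 ->
  flips_to s mu1 mu2 <->
  (forall e F F', dual_edge e F F' ->
     (mu1 e == mu2 e) = (odd (count_mem F s) == odd (count_mem F' s))).
Proof.
move=> mv1 mv2.
have eqE e F F' : dual_edge e F F' ->
    (foldl (@flip m n) mu1 s e == mu2 e) =
    ((mu1 e == mu2 e) == (odd (count_mem F s) == odd (count_mem F' s))).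
  move=> eF; rewrite foldl_flipE (count_borders s eF) -signr_odd.
  by rewrite MV_assignment_sign_eq // oddD negb_add.
split=> [sE e F F' eF | sE].
  by move: (eqE _ _ _ eF); rewrite sE eqxx => /esym/eqP.
apply/ffunP=> e; apply/eqP.
(* Every crease yields a dual edge, so the parity condition controls all values. *)
have [F [F' [neqF bE]]] := crease_facesP e.
have eF : dual_edge e F F' by rewrite /dual_edge neqF !bE /= !eqxx orbT.
by rewrite (eqE _ _ _ eF) (sE _ _ _ eF).
Qed.

Lemma weight_eq2 mu1 mu2 e : MV_assignment mu1 -> MV_assignment mu2 ->
  (weight mu1 mu2 e == 2) = (mu1 e == mu2 e).
Proof.
by move=> mv1 mv2; rewrite /weight; case: (mv1 e) => ->; case: (mv2 e) => ->.
Qed.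

(** If the assignments agree at [e], both faces are adjacent to the new vertex and take the color it
    does not have. Otherwise the edge is not subdivided and its ends get different colors. *)
Lemma proper_coloring_dual_edge mu1 mu2 (c : subdiv_vertex mu1 mu2 -> color)
    e F F' :
  MV_assignment mu1 -> MV_assignment mu2 ->
  proper_coloring (@subdiv_adj m n mu1 mu2) c -> dual_edge e F F' ->
  (c (inl F) == c (inl F')) = (mu1 e == mu2 e).
Proof.
move=> mv1 mv2 hc eF; rewrite -weight_eq2 //; have [w2 | w2] := boolP (_ == 2).
  have /and3P[_ bF bF'] := eF.
  have := hc (inl F) (inr (Sub e w2)) bF; have := hc (inl F') (inr (Sub e w2)) bF'.
  by case: (c (inr _)); case: (c (inl F)); case: (c (inl F')).
apply/negbTE/hc; apply/existsP; exists e.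
by rewrite w2.
Qed.

Lemma flips_to_color_class mu1 mu2 (c : subdiv_vertex mu1 mu2 -> color) k :
  MV_assignment mu1 -> MV_assignment mu2 ->
  proper_coloring (@subdiv_adj m n mu1 mu2) c ->
  flips_to (enum [set F : face m n | c (inl F) == k]) mu1 mu2.
Proof.
move=> mv1 mv2 hc; apply/flips_to_parityP => // e F F' eF.
rewrite -(proper_coloring_dual_edge mv1 mv2 hc eF).
(* Each face of the class is flipped exactly once, so parity is membership. *)
rewrite !count_uniq_mem ?enum_uniq // !mem_enum !inE !oddb.
by case: (c _); case: (c _); case: k.
Qed.

Lemma flips_to_odd_class mu1 mu2 (c : subdiv_vertex mu1 mu2 -> color) s :
  MV_assignment mu1 -> MV_assignment mu2 ->
  proper_coloring (@subdiv_adj m n mu1 mu2) c -> flips_to s mu1 mu2 ->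
  exists k, forall F, odd (count_mem F s) = (c (inl F) == k).
Proof.
move=> mv1 mv2 hc /(flips_to_parityP _ mv1 mv2) sE.
(* Across a dual edge, the parity of flips and the color change together, so [agree] takes equal
   values at both ends. *)
pose agree F := odd (count_mem F s) == (c (inl F) == Purple).
have agreeE : forall F F', agree F = agree F'.
  apply: dual_connected => e F F' eF; rewrite /agree.
  move: (sE _ _ _ eF); rewrite -(proper_coloring_dual_edge mv1 mv2 hc eF).
  by case: (odd _); case: (odd _); case: (c _); case: (c _).
have [/forallP aP | /forallPn[G naG]] := boolP [forall F, agree F].
  by exists Purple => F; apply/eqP/aP.
(* If [agree] fails at one face it fails everywhere, so the oddly flipped faces are the non-purple
   ones. *)
exists Teal => F; move: naG; rewrite (agreeE G F) /agree.
by case: (odd _); case: (c _).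
Qed.

(** An element with odd multiplicity occurs at least once in [s]. *)
Lemma card_odd_count (T : finType) (s : seq T) :
  (#|[set x | odd (count_mem x s)]| <= size s)%N.
Proof.
apply: leq_trans (card_size s); apply: subset_leq_card.
apply/subsetP=> x; rewrite inE => /odd_gt0.
by rewrite -has_count has_pred1.
Qed.

End Grid.

Theorem mainTheorem3 (m n : nat) (hm : (1 <= m)%N) (hn : (1 <= n)%N)
    (mu1 mu2 : {ffun crease m n -> int})
    (hmu1 : MV_assignment mu1) (hmu2 : MV_assignment mu2)
    (hv1 : locally_valid mu1) (hv2 : locally_valid mu2)
    (c : subdiv_vertex mu1 mu2 -> color)
    (hc : proper_coloring (@subdiv_adj m n mu1 mu2) c) :
  smallest_number_of_flips mu1 mu2
    (minn (number_colored c Purple) (number_colored c Teal)).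
Proof.
split.
  have reach k : exists s, flips_to s mu1 mu2 /\ size s = number_colored c k.
    exists (enum [set F : face m n | c (inl F) == k]).
    by split; [apply: flips_to_color_class | rewrite -cardE].
  by rewrite /minn; case: ifP => _; apply: reach.
move=> s /(flips_to_odd_class hmu1 hmu2 hc)[k kE].
(* The oddly flipped faces form the whole color class [k], which bounds the length of [s] from
   below. *)
have le_k : (number_colored c k <= size s)%N.
  apply: leq_trans (card_odd_count s); rewrite /number_colored.
  by apply/subset_leq_card/subsetP => F; rewrite !inE kE.
by case: k kE le_k => _ le_k; rewrite geq_min le_k ?orbT.
Qed.
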